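(* For all positive integers $m, n$ and every nonnegative integer $k$, $$r_m(n,k)=\sum_{i=1}^{m-1}\binom{n}{i}\,r_m(n-i,k)+\sum_{i=m}^{n}\binom{n}{i}\,r_m(n-i,k-1).$$
   Context: An outcome of a race among $n$ distinct participants is an ordered partition of an $n$-element set, i.e. a finite sequence of pairwise disjoint nonempty subsets (blocks) whose union is the whole set. A tie of size $s$ is a block with exactly $s$ elements (so $s=1$ is allowed). For positive integers $n, m$ and a nonnegative integer $k$, $r_m(n,k)$ denotes the number of outcomes of a race among $n$ distinct participants that contain exactly $k$ ties of size at least $m$, i.e. the number of ordered partitions of an $n$-element set having exactly $k$ blocks of cardinality at least $m$ (the other blocks having cardinality less than $m$). Conventions: $r_m(0,0)=1$; $r_m(0,k)=0$ for $k\geqslant 1$; and $r_m(n,k)=0$ whenever $n<0$ or $k<0$. Also $\binom{n}{i}=0$ for $i>n\geqslant 0$, and empty sums are $0$. *)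

(* Defs.v *)
From mathcomp Require Import all_boot all_order all_algebra.

Set Implicit Arguments.
Unset Strict Implicit.
Unset Printing Implicit Defensive.

(* The first component of s is the set of winners, and so on; two equal entries
   of s are not disjoint unless empty, so the blocks are pairwise distinct. *)
Definition ordered_partition (T : finType) (s : seq {set T}) : bool :=
  [&& set0 \notin s,
      pairwise (fun A B : {set T} => [disjoint A & B]) s
    & \bigcup_(B <- s) B == [set: T]].

Definition nb_ties (T : finType) (m : nat) (s : seq {set T}) : nat :=
  count (fun B : {set T} => m <= #|B|) s.

(* Only finiteness of the counted type requires bounding the number of blocks
   by n; no outcome is lost, by [size_ordered_partition] below. *)
Definition outcomes (m n k : nat) : {set {bseq n of {set 'I_n}}} :=
  [set s : {bseq n of {set 'I_n}} | ordered_partition s && (nb_ties m s == k)].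

(* The arguments n and k are integers, with value 0 if either is negative. *)
Definition r (m : nat) (n k : int) : nat :=
  match n, k with
  | Posz n', Posz k' => #|outcomes m n' k'|
  | _, _ => 0
  end.

Lemma size_ordered_partition (T : finType) (s : seq {set T}) :
  ordered_partition s -> size s <= #|T|.
Proof.
case/and3P=> s0 sd _.
suff: size s <= #|\bigcup_(B <- s) B| by move/leq_trans; apply; apply: max_card.
elim: s s0 sd => [|A s IHs] //=; rewrite inE negb_or => /andP[A0 s0] /andP[dA sd].
have dAU : [disjoint A & \bigcup_(B <- s) B].
  rewrite disjoints_subset setC_bigcup; apply/subsetP=> x xA.
  elim: s dA {IHs s0 sd} => [_|B s IH /= /andP[dB ds]].
    by rewrite big_nil inE.
  rewrite big_cons !inE IH // andbT.
  by rewrite (disjointFr dB xA).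
rewrite big_cons cardsU disjoint_setI0 // cards0 subn0 -add1n leq_add ?IHs //.
by rewrite card_gt0 eq_sym.
Qed.

Lemma r_00 (m : nat) : r m 0 0 = 1.
Proof.
rewrite /r /outcomes; apply/eqP/cards1P; exists [bseq].
apply/setP=> s; rewrite !inE -val_eqE /=.
have -> : val s = [::] by apply/nilP; rewrite /nilp -leqn0 size_bseq.
rewrite /ordered_partition big_nil /= !eqxx !andbT.
by apply/eqP/setP => -[].
Qed.

Lemma r_0S (m k : nat) : r m 0 (Posz k.+1) = 0.
Proof.
apply/eqP; rewrite cards_eq0; apply/eqP/setP=> s; rewrite !inE.
have -> : val s = [::] by apply/nilP; rewrite /nilp -leqn0 size_bseq.
by rewrite andbF.
Qed.

(* Main.v *)
Require Import Defs.
From mathcomp Require Import all_boot all_order all_algebra.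

(** Sort the outcomes by their set A of winners, which can be any nonempty set
    of participants. What follows A in the sequence is an arbitrary ordered
    partition of the complement of A, and it must contain k ties of size at
    least m, or k - 1 of them when A itself is such a tie
    ([card_outcomes_sum_winners]). The number of these continuations depends on
    A only through its cardinality, because a bijection between two sets of
    participants carries ordered partitions to ordered partitions with the same
    block sizes ([card_ordered_partitions_of]). Gathering the 'C(n, i) sets A
    of each size i gives the formula.

    The tail of an outcome partitions a subset of the participants, hence the
    relative notion [ordered_partition_of] used throughout. *)

Definition ordered_partition_of {T : finType} (D : {set T})
    (s : seq {set T}) : bool :=
  [&& set0 \notin s,
      pairwise (fun A B : {set T} => [disjoint A & B]) s
    & \bigcup_(B <- s) B == D].

(** * Counting bounded sequences *)

Lemma leq_card_bseq {X Y : finType} {a b : nat}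
    {P : pred (seq X)} {Q : pred (seq Y)} (f : seq X -> seq Y) :
    (forall t, Q t -> size t <= b) -> (forall s, P s -> Q (f s)) ->
    {in P &, injective f} ->
  #|[set s : {bseq a of X} | P s]| <= #|[set t : {bseq b of Y} | Q t]|.
Proof.
move=> szQ fPQ f_inj; pose F (s : {bseq a of X}) := insub_bseq b (f s).
have FE s : P (val s) -> val (F s) = f s.
  by move=> Ps; rewrite /F /insub_bseq val_insubd szQ ?fPQ.
rewrite -(@card_in_imset _ _ F); last first.
  move=> s t; rewrite !inE => Ps Pt /(congr1 val); rewrite !FE // => fst.
  exact/val_inj/f_inj.
apply/subset_leq_card/subsetP => _ /imsetP[s + ->].
by rewrite !inE => Ps; rewrite FE ?fPQ.
Qed.

(** The length bounds a and b only serve to make the counted types finite, so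
    they may differ as long as neither cuts off a sequence. *)
Lemma eq_card_bseq {X Y : finType} {a b : nat}
    {P : pred (seq X)} {Q : pred (seq Y)}
    (f : seq X -> seq Y) (g : seq Y -> seq X) :
    (forall s, P s -> size s <= a) -> (forall t, Q t -> size t <= b) ->
    (forall s, P s -> Q (f s)) -> (forall t, Q t -> P (g t)) ->
    {in P, cancel f g} -> {in Q, cancel g f} ->
  #|[set s : {bseq a of X} | P s]| = #|[set t : {bseq b of Y} | Q t]|.
Proof.
move=> szP szQ fPQ gQP fK gK; apply/eqP; rewrite eqn_leq; apply/andP; split.
- exact: leq_card_bseq szQ fPQ (can_in_inj fK).
- exact: leq_card_bseq szP gQP (can_in_inj gK).
Qed.

(** * Ordered partitions of a subset *)

Lemma ordered_partition_of_cons {T : finType} (D A : {set T}) (s : seq {set T}) :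
  ordered_partition_of D (A :: s) =
    [&& A != set0, A \subset D & ordered_partition_of (D :\: A) s].
Proof.
rewrite /ordered_partition_of inE negb_or [set0 == A]eq_sym /= big_cons.
set U := \bigcup_(B <- s) B.
have -> : all (fun B : {set T} => [disjoint A & B]) s = [disjoint A & U].
  rewrite /U; elim: s {U} => [|B s IHs] /=.
    by rewrite big_nil disjoints_subset setC0 subsetT.
  by rewrite big_cons IHs !disjoints_subset setCU subsetI.
case: (A != set0) => //=; case: (set0 \notin s); last by rewrite andbF.
case: (pairwise _ s); last by rewrite !andbF.
rewrite /= andbT; apply/andP/andP => [[dAU /eqP <-]|[sAD /eqP UE]].
- rewrite subsetUl setDUl setDv set0U; split=> //.
  by rewrite eqEsubset subsetDl subsetD subxx disjoint_sym dAU.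
- rewrite UE disjoint_sym; split; first by rewrite disjoints_subset setDE subsetIr.
  by rewrite -{1}(setIidPr sAD) setID.
Qed.

Lemma sub_ordered_partition_of {T : finType} {D B : {set T}} {s : seq {set T}} :
  ordered_partition_of D s -> B \in s -> B \subset D.
Proof.
by case/and3P=> _ _ /eqP <- Bs; rewrite bigcup_seq (bigcup_sup B).
Qed.

Lemma ordered_partition_of_imset {X T : finType} (f : X -> T) (E : {set X})
    (s : seq {set X}) : injective f ->
  ordered_partition_of (f @: E) (map (fun B : {set X} => f @: B) s) =
    ordered_partition_of E s.
Proof.
move=> f_inj; rewrite /ordered_partition_of.
congr [&& ~~ _, _ & _].
- by rewrite -{1}(imset0 f) mem_map //; apply: imset_inj.
- by rewrite pairwise_map; apply: eq_pairwise => A B /=; rewrite imset_disjoint.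
- rewrite big_map -(big_morph _ (imsetU f) (imset0 f)).
  by rewrite (inj_eq (imset_inj f_inj)).
Qed.

Lemma nb_ties_imset {X T : finType} (f : X -> T) (m : nat) (s : seq {set X}) :
  injective f ->
  nb_ties m (map (fun B : {set X} => f @: B) s) = nb_ties m s.
Proof.
move=> f_inj; rewrite /nb_ties count_map.
by apply: eq_count => B /=; rewrite card_imset.
Qed.

Lemma map_imsetK {X T : finType} (f : X -> T) : injective f ->
  cancel (map (fun B : {set X} => f @: B)) (map (fun B : {set T} => f @^-1: B)).
Proof.
move=> f_inj; apply: mapK => B; apply/setP=> x.
by rewrite inE mem_imset.
Qed.

(** Taking preimages loses nothing, as every block lies in the image of f. *)
Lemma map_preimsetK {X T : finType} {f : X -> T} {s : seq {set T}} :
    ordered_partition_of (f @: [set: X]) s ->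
  map (fun B : {set X} => f @: B) (map (fun B : {set T} => f @^-1: B) s) = s.
Proof.
move=> sP; rewrite -map_comp -[RHS]map_id; apply/eq_in_map=> B Bs /=.
apply/setP=> y; apply/imsetP/idP => [[x + ->]|yB]; first by rewrite inE.
have /imsetP[x _ yE] := subsetP (sub_ordered_partition_of sP Bs) y yB.
by exists x; rewrite ?inE -?yE.
Qed.

Lemma imset_enum_val {T : finType} (D : {set T}) :
  (@enum_val T (mem D)) @: setT = D.
Proof.
apply/setP=> x; apply/imsetP/idP => [[i _ ->]|xD]; first exact: enum_valP.
by exists (enum_rank_in xD x); rewrite ?enum_rankK_in.
Qed.

Lemma size_ordered_partition_of {T : finType} {D : {set T}} (s : seq {set T}) :
  ordered_partition_of D s -> size s <= #|D|.
Proof.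
rewrite -{1}(imset_enum_val D) => sP.
pose t := map (fun B : {set T} => @enum_val T (mem D) @^-1: B) s.
have tP : ordered_partition t.
  have := ordered_partition_of_imset _ setT t (@enum_val_inj T (mem D)).
  by rewrite (map_preimsetK sP) sP => /esym.
by have := size_ordered_partition tP; rewrite size_map card_ord.
Qed.

(** Any enumeration of D identifies its ordered partitions with the outcomes of
    a race among #|D| participants. The number c counts the ties that precede
    the sequence; if it exceeds k, the difference of integers is negative and
    both sides vanish. *)
Lemma card_ordered_partitions_of {T : finType} (D : {set T}) (m b k c : nat) :
    #|D| <= b ->
  #|[set s : {bseq b of {set T}} |
       ordered_partition_of D s && (c + nb_ties m s == k)]| =
    r m #|D|%:Z (k%:Z - c%:Z)%R.
Proof.
move=> Db; have [ck|kc] := leqP c k; last first.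
  have -> : (k%:Z - c%:Z)%R = Negz (c - k).-1.
    by rewrite NegzE prednK ?subn_gt0 // -subzn 1?ltnW // GRing.opprB.
  apply/eqP; rewrite cards_eq0; apply/eqP/setP=> s; rewrite !inE.
  by rewrite gtn_eqF ?andbF // ltn_addr.
rewrite subzn //= /outcomes.
pose f := @enum_val T (mem D); have f_inj : injective f := @enum_val_inj _ _.
have fD : f @: setT = D := imset_enum_val D.
apply: (eq_card_bseq
  (P := fun s => ordered_partition_of D s && (c + nb_ties m s == k))
  (Q := fun s => ordered_partition s && (nb_ties m s == k - c))
  (map (fun B : {set T} => f @^-1: B))
  (map (fun B : {set 'I_#|D|} => f @: B))).
- by move=> s /andP[/size_ordered_partition_of/leq_trans-> ].
- by move=> s /andP[/size_ordered_partition]; rewrite card_ord.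
- move=> s /andP[]; rewrite -{1}fD => sP.
  have := sP; rewrite -{1}(map_preimsetK sP) ordered_partition_of_imset // => tP.
  rewrite -{1}(map_preimsetK sP) nb_ties_imset // => /eqP <-.
  by rewrite addKn eqxx andbT.
- move=> s /andP[sP /eqP sk].
  rewrite -{1}fD ordered_partition_of_imset // nb_ties_imset // sk.
  by rewrite subnKC ?eqxx ?andbT.
- by move=> s /andP[sP _]; apply: map_preimsetK; rewrite fD.
- by move=> s _; apply: map_imsetK.
Qed.

(** * Splitting off the winners *)

(** A sum over the sets themselves rather than over their sizes: the fibre over
    A of the map sending an outcome to its winners is in bijection, by deleting
    A, with the ordered partitions of the complement of A. *)
Lemma card_outcomes_sum_winners (m n k : nat) : 0 < n ->
  r m n%:Z k%:Z =
    \sum_(A : {set 'I_n} | A != set0)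
       r m (n%:Z - #|A|%:Z)%R (k%:Z - (m <= #|A|)%:Z)%R.
Proof.
move=> n_gt0; pose winners (s : {bseq n of {set 'I_n}}) := head set0 s.
have sz s : ordered_partition_of [set: 'I_n] s -> size s <= n.
  by move/size_ordered_partition_of; rewrite cardsT card_ord.
rewrite /= -sum1_card.
rewrite (partition_big winners (fun A => A != set0)); last first.
  move=> [[|A s] ?]; rewrite inE /winners /=.
    (* With at least one participant, the empty sequence is no outcome. *)
    case/andP=> /and3P[_ _] /=; rewrite big_nil eq_sym -cards_eq0 cardsT card_ord.
    by rewrite eqn0Ngt n_gt0.
  case/andP=> sP _.
  by have := ordered_partition_of_cons setT A s; rewrite [LHS]sP => /esym/andP[].
apply: eq_bigr => A A0; rewrite sum1_card.
have AC : (n%:Z - #|A|%:Z = #|~: A|%:Z)%R.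
  have := cardsC A; rewrite card_ord => /(congr1 Posz) /= <-.
  by rewrite PoszD GRing.addrC GRing.addKr.
rewrite AC -(card_ordered_partitions_of _ _ n); last first.
  by rewrite -[leqRHS]card_ord max_card.
transitivity #|[set s : {bseq n of {set 'I_n}} |
    [&& ordered_partition_of setT s, nb_ties m s == k & head set0 s == A]]|.
  by apply: eq_card => s; rewrite [RHS]inE unfold_in inE -andbA.
have consP s : ordered_partition_of setT (A :: s) = ordered_partition_of (~: A) s.
  by rewrite ordered_partition_of_cons A0 subsetT setTD.
apply: (eq_card_bseq
  (P := fun s : seq {set 'I_n} =>
    [&& ordered_partition_of setT s, nb_ties m s == k & head set0 s == A])
  (Q := fun s : seq {set 'I_n} =>
    ordered_partition_of (~: A) s && ((m <= #|A|) + nb_ties m s == k))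
  behead (cons A)).
- by move=> s /andP[/sz].
- by move=> s /andP[]; rewrite -consP => /sz/ltnW.
- case=> [|B s] /and3P[sP sk /eqP /= BA]; first by rewrite -BA eqxx in A0.
  by rewrite -consP -BA sP.
- by move=> s /andP[sP sk] /=; rewrite consP sP sk eqxx.
- case=> [|B s] /and3P[_ _ /eqP /= BA]; first by rewrite -BA eqxx in A0.
  by rewrite BA.
- by [].
Qed.

Lemma sum_nonempty_card {T : finType} (F : nat -> nat) :
  \sum_(A : {set T} | A != set0) F #|A| =
    \sum_(1 <= i < #|T|.+1) 'C(#|T|, i) * F i.
Proof.
pose size_of (A : {set T}) : 'I_#|T|.+1 := inord #|A|.
have sizeE A : size_of A = #|A| :> nat by rewrite inordK // ltnS max_card.
have size_of_eq A i : (size_of A == i) = (#|A| == i).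
  by rewrite -(inj_eq val_inj) /= sizeE.
rewrite (partition_big size_of (fun i => i != ord0)) => [|A]; last first.
  by rewrite size_of_eq cards_eq0.
rewrite big_add1 big_mkord big_mkcond big_ord_recl /= add0n.
apply: eq_bigr => i _.
rewrite -card_draws -sum1dep_card big_distrl /=; apply: eq_big => A.
  by rewrite size_of_eq -cards_eq0 andb_idl // => /eqP ->.
by rewrite size_of_eq mul1n => /andP[_ /eqP ->].
Qed.

Theorem theorem3 (m n k : nat) (m_gt0 : 0 < m) (n_gt0 : 0 < n) :
  r m n%:Z k%:Z =
    \sum_(1 <= i < m) 'C(n, i) * r m (n%:Z - i%:Z)%R k%:Z
  + \sum_(m <= i < n.+1) 'C(n, i) * r m (n%:Z - i%:Z)%R (k%:Z - 1)%R.
Proof.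
rewrite card_outcomes_sum_winners //.
rewrite (sum_nonempty_card
  (fun i => r m (n%:Z - i%:Z)%R (k%:Z - (m <= i)%:Z)%R)) card_ord.
(* When m > n + 1, cut the first sum at n: the other binomials vanish. *)
have -> : \sum_(1 <= i < m) 'C(n, i) * r m (n%:Z - i%:Z)%R k%:Z =
    \sum_(1 <= i < minn m n.+1) 'C(n, i) * r m (n%:Z - i%:Z)%R k%:Z.
  have [//|nm] := leqP m n.+1.
  rewrite (big_cat_nat (n := n.+1)) ?(ltnW nm) //= -[RHS]addn0; congr (_ + _).
  by rewrite big_nat big1 // => i /andP[ni _]; rewrite bin_small.
have [mn|nm] := leqP m n.+1.
- rewrite (big_cat_nat (n := m)) //=; congr (_ + _).
    by apply: eq_big_nat => i /andP[_ im]; rewrite leqNgt im GRing.subr0.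
  by apply: eq_big_nat => i /andP[-> _].
- rewrite [X in _ = _ + X]big_geq ?(ltnW nm) // addn0.
  apply: eq_big_nat => i /andP[_ ilt].
  by rewrite leqNgt (ltn_trans ilt nm) GRing.subr0.
Qed.
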